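(* Let $\{x_k\}_{k\ge 0}$ be a sequence of iterates computed by the variable sample spectral gradient algorithm described in the context. Assume that $f_{\mathcal N}:\mathbb R^n\to\mathbb R$ is strongly convex, with unique minimizer $x_*$, that the gradients $\nabla f_j$, $j=1,\dots,N$, are Lipschitz-continuous on $\mathbb R^n$ with constant $L$, and that the three sequences $\{\zeta_k\}$, $\{\nu_k\}$, $\{\eta_k\}$ tend to $0$ $R$-linearly as $k\to+\infty$. Then, for every $\varepsilon\in(0,e^{-1})$, there exist $\hat\rho\in(0,1)$ and $Q>0$ such that the algorithm achieves $f_{\mathcal N}(x_k)-f_{\mathcal N}(x_* )<\varepsilon$ in at most $k_\varepsilon$ iterations (that is, the inequality holds for some index $k$ with $0\le k\le k_\varepsilon$), where $$k_\varepsilon=\left\lceil\frac{\log\big(f_{\mathcal N}(x_0)-f_{\mathcal N}(x_* )+Q\big)+1}{|\log(\hat\rho)|}\,\log(\varepsilon^{-1})+1\right\rceil.$$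
   Context: Problem. $f_1,\dots,f_N:\mathbb R^n\to\mathbb R$ are continuously differentiable, $\mathcal N=\{1,\dots,N\}$, and $f_{\mathcal N}(x)=\frac1N\sum_{j=1}^N f_j(x)$. For a nonempty $\mathcal S\subseteq\mathcal N$ put $f_{\mathcal S}(x)=\frac1{|\mathcal S|}\sum_{j\in\mathcal S}f_j(x)$ and $\nabla f_{\mathcal S}(x)=\frac1{|\mathcal S|}\sum_{j\in\mathcal S}\nabla f_j(x)$. $\|\cdot\|$ is the Euclidean norm and $\log$ is the natural logarithm. Algorithm (variable sample spectral gradient framework). Fixed parameters: $0<\sigma_m<1<\sigma_M<+\infty$, $0<c_1\le c_2<1$, and $\zeta_k>0$ with $\sum_{k\ge0}\zeta_k<+\infty$. Start from $x_0\in\mathbb R^n$, an initial nonempty subsample $\mathcal N_0\subseteq\mathcal N$ of size $N_0$, and an initial coefficient $\sigma_{-1}\in[\sigma_m,\sigma_M]$. At each iteration $k$: 1. (for $k\ge1$) A sample size $N_k\ge N_{k-1}$ and a (randomly generated) subsample $\mathcal N_k\subseteq\mathcal N$ with $|\mathcal N_k|=N_k$ are chosen, according to one of two subsampling rules, fixed for the whole run: nested, i.e. $\mathcal N_{k-1}\subseteq\mathcal N_k$; or non-nested, with the requirement $\mathcal N_{k-1}\cap\mathcal N_k\ne\emptyset$. The statement concerns any resulting realization of the subsamples. 2. (for $k\ge1$) Set $s_{k-1}=x_k-x_{k-1}$ and compute $y_{k-1}$ by one of the following formulas, fixed for the whole run: $y_{k-1}=\nabla f_{\mathcal N_k}(x_k)-\nabla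 f_{\mathcal N_k}(x_{k-1})$ (nested or non-nested case); $y_{k-1}=\nabla f_{\mathcal N_k}(x_k)-\nabla f_{\mathcal N_{k-1}}(x_{k-1})$ (nested case only); $y_{k-1}=\nabla f_{\mathcal I_k}(x_k)-\nabla f_{\mathcal I_k}(x_{k-1})$ with $\mathcal I_k=\mathcal N_k\cap\mathcal N_{k-1}$ (non-nested case only). Set $\sigma_{k-1}=\frac{s_{k-1}^ty_{k-1}}{s_{k-1}^ts_{k-1}}$ if this quantity is defined and lies in $[\sigma_m,\sigma_M]$, and $\sigma_{k-1}=1$ otherwise. 3. Set $d_k=-\sigma_{k-1}^{-1}\nabla f_{\mathcal N_k}(x_k)$. 4. Take a steplength $\alpha_k>0$ satisfying both $$f_{\mathcal N_k}(x_k+\alpha_kd_k)\le f_{\mathcal N_k}(x_k)+c_1\alpha_k\nabla f_{\mathcal N_k}(x_k)^td_k+\zeta_k,$$ $$\nabla f_{\mathcal N_k}(x_k+\alpha_kd_k)^td_k\ge c_2\nabla f_{\mathcal N_k}(x_k)^td_k.$$ 5. Set $x_{k+1}=x_k+\alpha_kd_k$. Approximation errors. For each $k\ge0$, $$\nu_k=\max\{|f_{\mathcal N_k}(x_k)-f_{\mathcal N}(x_k)|,\ |f_{\mathcal N_k}(x_{k+1})-f_{\mathcal N}(x_{k+1})|\},$$ $$\eta_k=\max\Big\{\big|\|\nabla f_{\mathcal N}(x_k)\|^2-\|\nabla f_{\mathcal N_k}(x_k)\|^2\big|,\ \big|\|\nabla f_{\mathcal N}(x_{k+1})\|^2-\|\nabla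 f_{\mathcal N_k}(x_{k+1})\|^2\big|\Big\}.$$ A nonnegative real sequence $\{a_k\}$ converges to $0$ $R$-linearly if there exist $M>0$ and $q\in(0,1)$ with $a_k\le Mq^k$ for all $k$. *)

(* Defs.v *)
From HB Require Import structures.
From mathcomp Require Import all_boot all_order all_algebra.
From mathcomp Require Import all_classical all_reals all_analysis.

Set Implicit Arguments.
Unset Strict Implicit.
Unset Printing Implicit Defensive.

Import Order.TTheory GRing.Theory Num.Theory.
Import numFieldNormedType.Exports.

Local Open Scope classical_set_scope.
Local Open Scope ring_scope.

Section Euclidean.
Context {R : realType} {n : nat}.
Implicit Types (u v x : 'rV[R]_n) (g : 'rV[R]_n -> R).

Definition dot u v : R := \sum_(i < n) u 0 i * v 0 i.

(* The norm [`|u|] that the library puts on row vectors is the sup norm, hence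
   a separate definition.  The two are equivalent, so [differentiable] and
   [continuous] below have their usual meaning on R^n. *)
Definition enorm u : R := Num.sqrt (dot u u).

Definition grad g x : 'rV[R]_n := \row_i 'D_(delta_mx 0 i) g x.

Definition C1 g : Prop := (forall x, differentiable g x) /\ continuous (grad g).

Definition strongly_convex g : Prop :=
  exists2 m : R, 0 < m &
    forall x y (t : R), 0 <= t <= 1 ->
      g (t *: x + (1 - t) *: y) <=
        t * g x + (1 - t) * g y - m / 2 * t * (1 - t) * enorm (x - y) ^+ 2.

Definition is_unique_minimizer g x : Prop :=
  (forall y, g x <= g y) /\ (forall z, (forall y, g z <= g y) -> z = x).

Definition grad_lipschitz (L : R) g : Prop :=
  forall x y, enorm (grad g x - grad g y) <= L * enorm (x - y).

End Euclidean.

Definition Rlinear_cvg0 {R : realType} (a : nat -> R) : Prop :=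
  (forall k, 0 <= a k) /\
  exists M q : R, [/\ 0 < M, 0 < q < 1 & forall k, a k <= M * q ^+ k].

Section Sampling.
Context {R : realType} {n N : nat}.
Implicit Types (f : 'I_N -> 'rV[R]_n -> R) (S : {set 'I_N}).

Definition fS f S (x : 'rV[R]_n) : R := #|S|%:R^-1 * \sum_(j in S) f j x.

Definition gradS f S (x : 'rV[R]_n) : 'rV[R]_n :=
  #|S|%:R^-1 *: \sum_(j in S) grad (f j) x.

Definition fN f : 'rV[R]_n -> R := fS f [set: 'I_N]%SET.

Definition gradN f : 'rV[R]_n -> 'rV[R]_n := gradS f [set: 'I_N]%SET.

Definition nu f (S : nat -> {set 'I_N}) (x : nat -> 'rV[R]_n) (k : nat) : R :=
  Num.max `|fS f (S k) (x k) - fN f (x k)|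
          `|fS f (S k) (x k.+1) - fN f (x k.+1)|.

Definition eta f (S : nat -> {set 'I_N}) (x : nat -> 'rV[R]_n) (k : nat) : R :=
  Num.max
    `|enorm (gradN f (x k)) ^+ 2 - enorm (gradS f (S k) (x k)) ^+ 2|
    `|enorm (gradN f (x k.+1)) ^+ 2 - enorm (gradS f (S k) (x k.+1)) ^+ 2|.

End Sampling.

Variant sampling_rule := Nested | NonNested.

Definition sampling_step {N : nat} (r : sampling_rule) (S S' : {set 'I_N}) : bool :=
  match r with
  | Nested => S \subset S'
  | NonNested => S :&: S' != finset.set0
  end.

Variant y_formula := YCurrent | YSuccessive | YIntersection.

Definition y_allowed (r : sampling_rule) (yf : y_formula) : bool :=
  match yf, r with
  | YCurrent, _ => true
  | YSuccessive, Nested => true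
  | YSuccessive, NonNested => false
  | YIntersection, Nested => false
  | YIntersection, NonNested => true
  end.

Section Algorithm.
Context {R : realType} {n N : nat}.
Implicit Types (f : 'I_N -> 'rV[R]_n -> R) (S : nat -> {set 'I_N})
               (x : nat -> 'rV[R]_n).

(* s_k and y_k, i.e. the quantities that iteration k+1 computes. *)
Definition s_vec x (k : nat) : 'rV[R]_n := x k.+1 - x k.

Definition y_vec (yf : y_formula) f S x (k : nat) : 'rV[R]_n :=
  match yf with
  | YCurrent => gradS f (S k.+1) (x k.+1) - gradS f (S k.+1) (x k)
  | YSuccessive => gradS f (S k.+1) (x k.+1) - gradS f (S k) (x k)
  | YIntersection =>
      gradS f (S k.+1 :&: S k) (x k.+1) - gradS f (S k.+1 :&: S k) (x k)
  end.

Definition spectral_coef (sm sM : R) (s y : 'rV[R]_n) : R :=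
  if (dot s s != 0) && (sm <= dot s y / dot s s <= sM)
  then dot s y / dot s s else 1.

(* [sg] is shifted by one: [sg k] stands for sigma_(k-1), the coefficient used
   at iteration k, so that [sg 0] is the initial sigma_(-1). *)
Definition dir f S x (sg : nat -> R) (k : nat) : 'rV[R]_n :=
  - ((sg k)^-1 *: gradS f (S k) (x k)).

Record vssg_params (sm sM c1 c2 : R) (zeta : nat -> R) : Prop := VssgParams {
  sigma_bounds : 0 < sm /\ sm < 1 /\ 1 < sM;
  wolfe_consts : 0 < c1 /\ c1 <= c2 /\ c2 < 1;
  zeta_gt0 : forall k, 0 < zeta k;
  zeta_summable : cvgn (series zeta)
}.

Record vssg_run (sm sM c1 c2 : R) (zeta : nat -> R)
    (r : sampling_rule) (yf : y_formula) f S x (sg alpha : nat -> R) : Prop :=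
  VssgRun {
    rule_ok : y_allowed r yf;
    sample0 : S 0%N != finset.set0;
    sample_size : forall k, (#|S k| <= #|S k.+1|)%N;
    sample_step : forall k, sampling_step r (S k) (S k.+1);
    sigma0 : sm <= sg 0%N <= sM;
    sigmaS : forall k,
      sg k.+1 = spectral_coef sm sM (s_vec x k) (y_vec yf f S x k);
    step_gt0 : forall k, 0 < alpha k;
    armijo : forall k,
      fS f (S k) (x k + alpha k *: dir f S x sg k) <=
        fS f (S k) (x k)
        + c1 * alpha k * dot (gradS f (S k) (x k)) (dir f S x sg k) + zeta k;
    curvature : forall k,
      dot (gradS f (S k) (x k + alpha k *: dir f S x sg k)) (dir f S x sg k) >=
        c2 * dot (gradS f (S k) (x k)) (dir f S x sg k);
    iterate : forall k, x k.+1 = x k + alpha k *: dir f S x sg k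
  }.

End Algorithm.

(* Main.v *)
(** By the curvature condition and the Lipschitz gradients, the steplength is
    bounded below by [(1 - c2) sigma / L], so the Armijo condition decreases
    [f_S] by a fixed multiple of [|grad f_S|^2], up to [zeta].  Exchanging [f_S]
    for [f_N] costs [nu] and [eta], and strong convexity bounds the optimality
    gap of [f_N] by a multiple of [|grad f_N|^2].  Hence that gap is
    contracted by a fixed factor up to an R-linear error, so it is at most
    [rho ^ k * (gap_0 + Q)] with [rho] and [Q] independent of [eps]. *)
Require Import Defs.
From mathcomp Require Import all_boot all_order all_algebra.
From mathcomp Require Import all_classical all_reals all_analysis.
From mathcomp Require Import ring lra.
Import Order.TTheory GRing.Theory Num.Theory.
Import numFieldNormedType.Exports.
Local Open Scope classical_set_scope.
Local Open Scope ring_scope.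

(** * Euclidean inner product and the Cauchy-Schwarz inequality *)

Section Dot.
Context {R : realType} {n : nat}.
Implicit Types (u v w : 'rV[R]_n) (a : R).

Lemma dotC u v : dot u v = dot v u.
Proof. by apply: eq_bigr => i _; rewrite mulrC. Qed.

Lemma dotDl u v w : dot (u + v) w = dot u w + dot v w.
Proof. by rewrite -big_split; apply: eq_bigr => i _; rewrite mxE mulrDl. Qed.

Lemma dotZl a u v : dot (a *: u) v = a * dot u v.
Proof. by rewrite mulr_sumr; apply: eq_bigr => i _; rewrite mxE mulrA. Qed.

Lemma dotNl u v : dot (- u) v = - dot u v.
Proof. by rewrite -scaleN1r dotZl mulN1r. Qed.

Lemma dotBl u v w : dot (u - v) w = dot u w - dot v w.
Proof. by rewrite dotDl dotNl. Qed.

Lemma dotDr u v w : dot u (v + w) = dot u v + dot u w.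
Proof. by rewrite dotC dotDl !(dotC u). Qed.

Lemma dotZr a u v : dot u (a *: v) = a * dot u v.
Proof. by rewrite dotC dotZl dotC. Qed.

Lemma dotNr u v : dot u (- v) = - dot u v.
Proof. by rewrite dotC dotNl dotC. Qed.

Lemma dot_suml (I : finType) (P : pred I) (F : I -> 'rV[R]_n) v :
  dot (\sum_(i | P i) F i) v = \sum_(i | P i) dot (F i) v.
Proof.
apply: (big_morph (fun u => dot u v)) => [u w|]; first exact: dotDl.
by rewrite -(scale0r v) dotZl mul0r.
Qed.

Lemma dot_ge0 u : 0 <= dot u u.
Proof. by apply: sumr_ge0 => i _; rewrite -expr2 sqr_ge0. Qed.

Lemma dot_eq0 u : dot u u = 0 -> u = 0.
Proof.
move=> /eqP; rewrite psumr_eq0 => [/allP u0|i _]; last by rewrite -expr2 sqr_ge0.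
apply/rowP => i; rewrite mxE; apply/eqP.
by have := u0 i (mem_index_enum i); rewrite mulf_eq0 orbb.
Qed.

Lemma enorm_ge0 u : 0 <= enorm u.
Proof. exact: sqrtr_ge0. Qed.

Lemma enorm_sqr u : enorm u ^+ 2 = dot u u.
Proof. by rewrite sqr_sqrtr // dot_ge0. Qed.

Lemma enormZ a u : enorm (a *: u) = `|a| * enorm u.
Proof.
rewrite /enorm dotZl dotZr mulrA -expr2 sqrtrM ?sqr_ge0//.
by rewrite sqrtr_sqr.
Qed.

Lemma dot_le_enorm u v : dot u v <= enorm u * enorm v.
Proof.
apply: le_trans (ler_norm _) _.
rewrite -(@ler_pXn2r _ 2) ?nnegrE ?mulr_ge0 ?enorm_ge0//.
rewrite real_normK ?num_real// exprMn !enorm_sqr.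
have [v0|v_neq0] := eqVneq (dot v v) 0.
  by rewrite v0 (dot_eq0 _ v0) -(scale0r u) dotZr mul0r expr0n mulr0.
have v_gt0 : 0 < dot v v by rewrite lt_def v_neq0 dot_ge0.
(* The square of this vector is [dot v v] times the Cauchy-Schwarz defect
   [dot u u * dot v v - dot u v ^+ 2]. *)
have := dot_ge0 (dot v v *: u - dot u v *: v).
rewrite dotBl !dotDr !dotNr !dotZl !dotZr (dotC v u).
by move=> h; rewrite -subr_ge0 -(pmulr_rge0 _ v_gt0); lra.
Qed.

End Dot.

(** * Gradients, and the gradient bound on the optimality gap *)

Section Gradient.
Context {R : realType} {n : nat}.
Implicit Types (g : 'rV[R]_n -> R) (x v : 'rV[R]_n).

Lemma derive_grad g x v : differentiable g x -> 'D_v g x = dot (grad g x) v.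
Proof.
move=> dg; rewrite deriveE// {1}(row_sum_delta v) linear_sum.
apply: eq_bigr => i _; rewrite linearZ mxE deriveE//.
by rewrite mulrC.
Qed.

(* The gap is at most [- grad g x . v - m/2 |v|^2] with [v = xs - x]; maximize
   this over all [v]. *)
Lemma strongly_convex_gap_le g xs :
  (forall x, differentiable g x) -> strongly_convex g ->
  exists2 m : R, 0 < m & forall x, m * (g x - g xs) <= enorm (grad g x) ^+ 2.
Proof.
move=> dg [m m_gt0 cvx]; exists (2 * m); first by rewrite mulr_gt0.
move=> x; pose v := xs - x; pose A := m / 2 * enorm v ^+ 2.
suff slope : 'D_v g x <= g xs - g x - A.
  move: slope; rewrite derive_grad// => slope.
  (* Completing the square: this gives [- 2 * m * dot (grad g x) v - m ^+ 2 * dot v v <= dot (grad g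
     x) (grad g x)], to be combined with [2 * m] times [slope]. *)
  have : 0 <= dot (m *: v + grad g x) (m *: v + grad g x) by exact: dot_ge0.
  rewrite dotDl !dotDr !dotZl !dotZr enorm_sqr (dotC v (grad g x)).
  by move: slope; rewrite /A enorm_sqr; nra.
(* Strong convexity between [xs] and [x] with weight [h] bounds the difference quotient for
   [0 < h < 1]; hence the limits are taken from the right. *)
have cvD : (fun h : R => h^-1 *: (g (h *: v + x) - g x)) @ 0^'+ --> 'D_v g x.
  by apply: cvg_dnbhs_at_right; exact: diff_derivable.
have cvA : (fun h : R => g xs - g x - A * (1 - h)) @ 0^'+ --> g xs - g x - A.
  rewrite -[X in _ --> _ - X]mulr1 -[X in _ --> _ - A * X](subr0 1).
  by apply: cvg_at_right_filter; apply: cvgB; [exact: cvg_cst|apply: cvgMl_tmp;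
    apply: cvgB; [exact: cvg_cst|exact: cvg_id]].
apply: ler_cvg_to cvD cvA _; near=> h.
have h_gt0 : 0 < h by near: h; exact: nbhs_right_gt.
have h_lt1 : h < 1 by near: h; exact: nbhs_right_lt.
have h01 : 0 <= h <= 1 by rewrite !ltW.
have := cvx xs x h h01.
have -> : h *: xs + (1 - h) *: x = h *: v + x.
  by rewrite /v scalerBr scalerBl scale1r addrA addrAC.
rewrite -/v => le_g; rewrite /GRing.scale/= ler_pdivrMl// /A; lra.
Unshelve. all: by end_near. Qed.

End Gradient.

(** * Differentiation and Lipschitz bounds for subsample averages *)

Section Averages.
Context {R : realType} {n N : nat}.
Implicit Types (f : 'I_N -> 'rV[R]_n -> R) (A : {set 'I_N}) (x v : 'rV[R]_n).

Lemma is_derive_fS f A x v :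
  (forall j, differentiable (f j) x) ->
  is_derive x v (fS f A) (#|A|%:R^-1 * \sum_(j in A) 'D_v (f j) x).
Proof.
move=> df.
have -> : fS f A = #|A|%:R^-1 \*: \sum_(j in A) f j.
  by apply/funext => y; rewrite /fS /= fct_sumE.
apply: is_deriveZ; apply: (big_ind2 (fun g (l : R) => is_derive x v g l)) => //.
- exact: is_derive_cst.
- by move=> g1 l1 g2 l2 *; exact: is_deriveD.
- by move=> j _; apply: derivableP; exact: diff_derivable.
Qed.

Lemma differentiable_fS f A x :
  (forall j, differentiable (f j) x) -> differentiable (fS f A) x.
Proof.
move=> df; have -> : fS f A = #|A|%:R^-1 \*: \sum_(j in A) f j.
  by apply/funext => y; rewrite /fS /= fct_sumE.
apply: differentiableZ; apply: (big_ind (fun g => differentiable g x)) => //.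
by move=> g1 g2 *; exact: differentiableD.
Qed.

Lemma grad_fS f A x :
  (forall j, differentiable (f j) x) -> grad (fS f A) x = gradS f A x.
Proof.
move=> df; apply/rowP => i; rewrite !mxE.
have := is_derive_fS f A x (delta_mx 0 i) df => /@derive_val ->.
by rewrite summxE; congr (_ * _); apply: eq_bigr => j _; rewrite mxE.
Qed.

(** Cauchy-Schwarz and the Lipschitz bound apply to each summand, and averaging over a nonempty
    sample keeps the constant [L]. *)
Lemma gradS_lipschitz_dot f A L x v : A != finset.set0 ->
  (forall j, grad_lipschitz L (f j)) ->
  dot (gradS f A (x + v) - gradS f A x) v <= L * enorm v ^+ 2.
Proof.
rewrite -card_gt0 => A_gt0 lip.
rewrite /gradS -scalerBr -sumrB dotZl dot_suml ler_pdivrMl ?ltr0n//.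
rewrite mulr_natl -sumr_const; apply: ler_sum => j _.
apply: le_trans (dot_le_enorm _ _) _.
rewrite expr2 mulrA ler_wpM2r ?enorm_ge0//.
by apply: le_trans (lip j _ _) _; rewrite addrC addKr.
Qed.

End Averages.

(** * R-linear sequences, perturbed contractions and iteration counts *)

Section RLinear.
Context {R : realType}.
Implicit Types a b u : nat -> R.

Lemma Rlinear_cvg0D a b :
  Rlinear_cvg0 a -> Rlinear_cvg0 b -> Rlinear_cvg0 (fun k => a k + b k).
Proof.
move=> [a0 [M [q [M_gt0 /andP[q_gt0 q_lt1] aq]]]].
move=> [b0 [M' [q' [M'_gt0 /andP[q'_gt0 q'_lt1] bq]]]].
split=> [k|]; first exact: addr_ge0.
exists (M + M'), (Num.max q q'); split; first exact: addr_gt0.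
  by rewrite lt_max q_gt0 gt_max q_lt1.
move=> k; rewrite mulrDl lerD//.
  apply: le_trans (aq k) _; rewrite ler_pM2l// lerXn2r ?nnegrE ?le_max ?lexx//.
    exact: ltW.
  by rewrite ltW.
apply: le_trans (bq k) _; rewrite ler_pM2l// lerXn2r ?nnegrE ?le_max ?lexx ?orbT//.
  exact: ltW.
by rewrite (ltW q'_gt0) orbT.
Qed.

Lemma Rlinear_cvg0Z c a : 0 < c ->
  Rlinear_cvg0 a -> Rlinear_cvg0 (fun k => c * a k).
Proof.
move=> c_gt0 [a0 [M [q [M_gt0 q01 aq]]]].
split=> [k|]; first by rewrite mulr_ge0// ltW.
exists (c * M), q; split=> //; first exact: mulr_gt0.
by move=> k; rewrite -mulrA ler_pM2l.
Qed.

(* [rho] is taken strictly larger than both the contraction factor and the rate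
   of the perturbation, which leaves room to absorb the perturbation in [Q]. *)
Lemma perturbed_contraction c u a : c < 1 -> (forall k, 0 <= u k) ->
  Rlinear_cvg0 a -> (forall k, u k.+1 <= c * u k + a k) ->
  exists rho Q : R, [/\ 0 < rho < 1, 1 <= Q &
    forall k, u k <= rho ^+ k * (u 0%N + Q)].
Proof.
move=> c_lt1 u_ge0 [_ [M [q [M_gt0 /andP[q_gt0 q_lt1] aq]]]] rec.
(* The sign of [c] is unknown, but [p] is positive because [q] is; [rho] is the midpoint of [p] and
   1. *)
pose p := Num.max c q; pose rho := (1 + p) / 2.
have cp : c <= p by rewrite le_max lexx.
have qp : q <= p by rewrite le_max lexx orbT.
have p_lt1 : p < 1 by rewrite gt_max c_lt1.
have p_rho : p < rho by rewrite /rho; lra.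
have rho_gt0 : 0 < rho by rewrite /rho; lra.
have rhop_gt0 : 0 < rho - p by rewrite subr_gt0.
(* The quotient makes [(rho - p) * Q] absorb [M] in the induction; the added 1 gives [1 <= Q], which
   later makes [ln (u 0 + Q)] nonnegative. *)
pose Q := M / (rho - p) + 1.
have Q_ge1 : 1 <= Q by rewrite lerDr divr_ge0// ltW.
have MQ : M <= (rho - p) * Q.
  by rewrite /Q mulrDr mulrCA divff ?gt_eqF// !mulr1 lerDl ltW.
exists rho, Q; split=> //; first by rewrite rho_gt0 /rho; lra.
elim=> [|k IHk]; first by rewrite expr0 mul1r lerDl (le_trans ler01).
have pow_ge0 : 0 <= rho ^+ k by rewrite exprn_ge0// ltW.
apply: le_trans (rec k) _.
have step1 : c * u k <= p * (rho ^+ k * (u 0%N + Q)).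
  apply: le_trans (_ : p * u k <= _); first exact: ler_wpM2r.
  by apply: ler_wpM2l => //; lra.
have step2 : a k <= M * rho ^+ k.
  apply: le_trans (aq k) _; rewrite ler_pM2l// lerXn2r ?nnegrE//; lra.
apply: le_trans (lerD step1 step2) _.
have := u_ge0 0%N; rewrite exprS => u0.
have : 0 <= (rho - p) * u 0%N by rewrite mulr_ge0// ltW.
nra.
Qed.

(* Since [ln eps^-1 > 1], the product in the iteration bound dominates the sum
   [ln (u 0 + Q) + ln eps^-1] that the geometric decay requires. *)
Lemma geometric_complexity (u : nat -> R) rho Q eps :
  0 < rho < 1 -> 1 <= Q -> 0 <= u 0%N ->
  (forall k, u k <= rho ^+ k * (u 0%N + Q)) ->
  0 < eps < expR (- 1) ->
  exists2 k : nat,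
    k%:Z <= Num.ceil ((ln (u 0%N + Q) + 1) / `|ln rho| * ln eps^-1 + 1) &
    u k < eps.
Proof.
move=> /andP[rho_gt0 rho_lt1] Q_ge1 u0 ub /andP[eps_gt0 eps_lt].
have lnrho : ln rho < 0 by rewrite ln_lt0// rho_gt0.
have lneps : 1 < ln eps^-1.
  rewrite lnV ?posrE// ltrNr -[ltRHS](@expRK R) ltr_ln ?posrE ?expR_gt0//.
have uQ_ge1 : 1 <= u 0%N + Q by lra.
have lnuQ : 0 <= ln (u 0%N + Q) by exact: ln_ge0.
set D := _ / _ * _ + 1.
have D_ge0 : 0 <= D.
  by rewrite addr_ge0// !mulr_ge0 ?invr_ge0//; lra.
have ceil_ge0 : 0 <= Num.ceil D by rewrite ceil_ge0; lra.
(* The witness is the ceiling itself, a natural number since [D] is nonnegative. *)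
have [k kE Dk] : exists2 k : nat, k%:Z = Num.ceil D & D <= k%:R.
  exists `|Num.ceil D|%N; first by rewrite gez0_abs.
  by have := ceil_ge D; rewrite -[in X in X -> _](gez0_abs ceil_ge0).
exists k; first by rewrite kE.
apply: le_lt_trans (ub k) _.
have powk_gt0 : 0 < rho ^+ k by rewrite exprn_gt0.
have uQ_gt0 : 0 < u 0%N + Q by lra.
rewrite -ltr_ln ?posrE ?mulr_gt0// lnM ?posrE// lnXn// -mulr_natl.
have : D * `|ln rho| <= k%:R * `|ln rho| by rewrite ler_wpM2r.
rewrite /D mulrDl mulrAC divfK ?normr_eq0 ?lt_eqF// ltr0_norm//.
move: lneps; rewrite lnV ?posrE// => lneps.
(* The final inequality is strict because the [+ 1] in [D] contributes an extra [- ln rho > 0]. *)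
have : 0 <= ln (u 0%N + Q) * (- ln eps - 1) by rewrite mulr_ge0//; lra.
lra.
Qed.

End RLinear.

(** * Descent estimates along a run of the algorithm *)

Section Algorithm.
Context {R : realType} {n N : nat}.
Context {f : 'I_N -> 'rV[R]_n -> R} {sm sM c1 c2 : R} {zeta : nat -> R}.
Context {r : sampling_rule} {yf : y_formula} {S : nat -> {set 'I_N}}.
Context {x : nat -> 'rV[R]_n} {sg alpha : nat -> R}.
Hypothesis params : vssg_params sm sM c1 c2 zeta.
Hypothesis run : vssg_run sm sM c1 c2 zeta r yf f S x sg alpha.

Lemma sample_neq0 k : S k != finset.set0.
Proof.
rewrite -card_gt0; elim: k => [|k IHk].
  by rewrite card_gt0; exact: sample0 run.
exact: leq_trans IHk (sample_size run k).
Qed.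

Lemma sg_gt0 k : 0 < sg k.
Proof.
have [sm_gt0 [sm_lt1 sM_gt1]] := sigma_bounds params.
case: k => [|k]; first by have /andP[+ _] := sigma0 run; exact: lt_le_trans.
rewrite (sigmaS run) /spectral_coef; case: ifP => // /andP[_ /andP[+ _]].
exact: lt_le_trans.
Qed.

(** Along [d], curvature forces the slope to rise by at least [(1 - c2) * (sg k)^-1 * dot g g],
    while Lipschitz continuity allows at most [L * alpha k * dot d d]. As [d] is [- (sg k)^-1 *: g],
    a nonzero [g] cancels and leaves the bound. *)
Lemma step_lower_bound L k : 0 < L -> (forall j, grad_lipschitz L (f j)) ->
  gradS f (S k) (x k) != 0 -> (1 - c2) * sg k / L <= alpha k.
Proof.
move=> L_gt0 lip g_neq0; have := curvature run k.
have := @gradS_lipschitz_dot _ _ _ f (S k) L (x k) (alpha k *: dir f S x sg k)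
  (sample_neq0 k) lip.
have a_gt0 := step_gt0 run k; have s_gt0 := sg_gt0 k.
set d := dir f S x sg k; set g := gradS f (S k) (x k).
have G_gt0 : 0 < dot g g.
  rewrite lt_def dot_ge0 andbT; apply: contraNneq g_neq0 => /dot_eq0 g0.
  exact/eqP.
have siG_gt0 : 0 < (sg k)^-1 * dot g g by rewrite mulr_gt0 ?invr_gt0.
have gdE : dot g d = - ((sg k)^-1 * dot g g) by rewrite /d /dir dotNr dotZr.
have ddE : dot d d = (sg k)^-1 * ((sg k)^-1 * dot g g).
  by rewrite {1}/d /dir dotNl dotZl gdE mulrN opprK.
rewrite dotZr dotBl enormZ exprMn enorm_sqr real_normK ?num_real// gdE ddE.
set P := dot (gradS _ _ _) d => lipP curvP.
(* The Lipschitz estimate was taken for the displacement [alpha k *: d]; one factor [alpha k] is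
   divided out. *)
have {lipP} : P - - ((sg k)^-1 * dot g g)
    <= L * alpha k * (sg k)^-1 * ((sg k)^-1 * dot g g).
  by rewrite -(ler_pM2l a_gt0); lra.
move=> lipP; have : (1 - c2) * ((sg k)^-1 * dot g g)
    <= L * alpha k * (sg k)^-1 * ((sg k)^-1 * dot g g) by lra.
rewrite ler_pM2r// -(ler_pM2r s_gt0) divfK ?gt_eqF//.
by rewrite ler_pdivrMr// (mulrC L).
Qed.

(** The factor [sg k] in the lower bound on the step cancels the [(sg k)^-1] of the direction, so
    the decrease constant is the same at every iteration. *)
Lemma sample_decrease L k : 0 < L -> (forall j, grad_lipschitz L (f j)) ->
  fS f (S k) (x k.+1) <= fS f (S k) (x k)
    - c1 * (1 - c2) / L * enorm (gradS f (S k) (x k)) ^+ 2 + zeta k.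
Proof.
move=> L_gt0 lip; have [c1_gt0 [_ c2_lt1]] := wolfe_consts params.
rewrite (iterate run); apply: le_trans (armijo run k) _.
rewrite lerD2r lerD2l dotNr dotZr enorm_sqr mulrN lerN2.
(* At a zero sample gradient both decrease terms vanish, so no bound on the step is required. *)
have [->|g_neq0] := eqVneq (gradS f (S k) (x k)) 0.
  by rewrite -(scale0r 0) dotZl mul0r !mulr0.
rewrite mulrA ler_wpM2r ?dot_ge0// ler_pdivlMr ?sg_gt0//.
have := step_lower_bound _ k L_gt0 lip g_neq0.
rewrite -(ler_pM2l c1_gt0); apply: le_trans.
by rewrite le_eqVlt; apply/orP; left; apply/eqP; ring.
Qed.

(** Function values are exchanged at both [x k] and [x k.+1], hence [2 * nu]; the squared gradient
    is exchanged once, with weight [b]. *)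
Lemma full_decrease L b k : 0 < L -> (forall j, grad_lipschitz L (f j)) ->
  b = c1 * (1 - c2) / L ->
  fN f (x k.+1) <= fN f (x k) - b * enorm (gradN f (x k)) ^+ 2
    + (b * eta f S x k + 2 * nu f S x k + zeta k).
Proof.
move=> L_gt0 lip bE; have [c1_gt0 [_ c2_lt1]] := wolfe_consts params.
have b_gt0 : 0 < b by rewrite bE divr_gt0// mulr_gt0// subr_gt0.
have := sample_decrease _ k L_gt0 lip; rewrite -bE.
have : `|fS f (S k) (x k) - fN f (x k)| <= nu f S x k by rewrite le_max lexx.
have : `|fS f (S k) (x k.+1) - fN f (x k.+1)| <= nu f S x k.
  by rewrite le_max lexx orbT.
have : `|enorm (gradN f (x k)) ^+ 2 - enorm (gradS f (S k) (x k)) ^+ 2|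
    <= eta f S x k by rewrite /eta le_max lexx.
rewrite !ler_norml => /andP[_]; rewrite -(ler_pM2l b_gt0) => eta_k.
by move=> /andP[nu1 _] /andP[_ nu2] dec; lra.
Qed.

Lemma gap_geometric L xs : (forall j, C1 (f j)) -> strongly_convex (fN f) ->
  (forall y, fN f xs <= fN f y) -> (forall j, grad_lipschitz L (f j)) ->
  Rlinear_cvg0 zeta -> Rlinear_cvg0 (nu f S x) -> Rlinear_cvg0 (eta f S x) ->
  exists rho Q : R, [/\ 0 < rho < 1, 1 <= Q & forall k,
    fN f (x k) - fN f xs <= rho ^+ k * (fN f (x 0%N) - fN f xs + Q)].
Proof.
move=> f_C1 cvx xs_min lipL zeta0 nu0 eta0.
have df y j : differentiable (f j) y by case: (f_C1 j).
have [m m_gt0 gap_le] := strongly_convex_gap_le (fN f) xs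
  (fun y => differentiable_fS _ _ _ (df y)) cvx.
(* Enlarging the Lipschitz constant makes it positive, so that it can be divided by. *)
pose L1 := Num.max L 1.
have L1_gt0 : 0 < L1 by rewrite lt_max ltr01 orbT.
have lip j : grad_lipschitz L1 (f j).
  move=> y z; apply: le_trans (lipL j y z) _.
  by rewrite ler_wpM2r ?enorm_ge0// le_max lexx.
have [c1_gt0 [_ c2_lt1]] := wolfe_consts params.
pose b := c1 * (1 - c2) / L1.
have b_gt0 : 0 < b by rewrite divr_gt0// mulr_gt0// subr_gt0.
(* Replacing the squared gradient by [m] times the gap in the decrease estimate gives the factor
   [1 - b * m]. *)
apply: (@perturbed_contraction _ (1 - b * m) (fun k => fN f (x k) - fN f xs)
  (fun k => b * eta f S x k + 2 * nu f S x k + zeta k)).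
- by rewrite gtrBl mulr_gt0.
- by move=> k; rewrite subr_ge0.
- by do 2![apply: Rlinear_cvg0D => //]; apply: Rlinear_cvg0Z.
- move=> k; have := full_decrease _ b k L1_gt0 lip erefl.
  have := gap_le (x k); rewrite (grad_fS f _ (x k) (df _)) -(ler_pM2l b_gt0).
  rewrite -/(gradN f (x k)) => *; lra.
Qed.

End Algorithm.

Theorem theorem3p4 (R : realType) (n N : nat)
    (f : 'I_N -> 'rV[R]_n -> R)
    (sm sM c1 c2 : R) (zeta : nat -> R)
    (r : sampling_rule) (yf : y_formula)
    (S : nat -> {set 'I_N}) (x : nat -> 'rV[R]_n) (sg alpha : nat -> R)
    (L : R) (xs : 'rV[R]_n) :
  (forall j, C1 (f j)) ->
  vssg_params sm sM c1 c2 zeta ->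
  vssg_run sm sM c1 c2 zeta r yf f S x sg alpha ->
  strongly_convex (fN f) ->
  is_unique_minimizer (fN f) xs ->
  (forall j, grad_lipschitz L (f j)) ->
  Rlinear_cvg0 zeta ->
  Rlinear_cvg0 (nu f S x) ->
  Rlinear_cvg0 (eta f S x) ->
  forall eps : R, 0 < eps < expR (- 1) ->
  exists rho Q : R, [/\ 0 < rho < 1, 0 < Q &
    exists2 k : nat,
      k%:Z <= Num.ceil ((ln (fN f (x 0%N) - fN f xs + Q) + 1)
                          / `|ln rho| * ln eps^-1 + 1) &
      fN f (x k) - fN f xs < eps].
Proof.
move=> f_C1 params run cvx [xs_min _] lip zeta0 nu0 eta0 eps eps01.
have [rho [Q [rho01 Q_ge1 decay]]] :=
  gap_geometric params run _ xs f_C1 cvx xs_min lip zeta0 nu0 eta0.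
exists rho, Q; split=> //; first exact: lt_le_trans Q_ge1.
apply: (geometric_complexity (fun k => fN f (x k) - fN f xs)) => //.
by rewrite subr_ge0.
Qed.
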